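(* Let $0<q<s<\infty$. Assume that for every $T\in\mathcal{H}$, $a\in A$, $c\in C$, $g\in G$ the map $W\to\mathbb{R}$, $\psi\mapsto\mathbf{M}(T,a,c,g,\psi)$, is continuous. Let $T\in\mathcal{H}$ and, for $j\in I$, let $\sigma_j\in\mathbb{R}\setminus\{0\}$, $a_j\in A$, $c_j\in C$, $g_j\in G$. Then the family $\left((\sigma_j,T,a_j,c_j,g_j,\psi)\right)_{j\in I}$ is $\mathbf{M}$-mixed $(s;q)$-summable if and only if $$\left[\sum_{j\in I}|\sigma_j|^q\left(\int_W|\mathbf{M}(T,a_j,c_j,g_j,\psi)|^s\,d\mu(\psi)\right)^{q/s}\right]^{1/q}<\infty$$ for every Borel probability measure $\mu$ on $W$. In this case $$\sup_{\mu}\left[\sum_{j\in I}|\sigma_j|^q\left(\int_W|\mathbf{M}(T,a_j,c_j,g_j,\psi)|^s\,d\mu(\psi)\right)^{q/s}\right]^{1/q}=\mathfrak{m}^{\mathbf{M}}_{(s;q)}\left((\sigma_j,T,a_j,c_j,g_j,\psi)\right)_{j\in I},$$ where the supremum is over all Borel probability measures $\mu$ on $W$.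
   Context: $A,B,C$ are non-void sets, $\mathcal{H}$ is a non-void family of mappings from $A$ into $B$, $G$ is a Banach space, $W$ is a (non-void) compact Hausdorff space, $I$ is a non-void index set, and $\mathbf{M}:\mathcal{H}\times A\times C\times G\times W\to\mathbb{R}$ is a map. Let $r$ be determined by $\frac1r+\frac1s=\frac1q$. The family $\left((\sigma_j,T,a_j,c_j,g_j,\psi)\right)_{j\in I}$ (with $\psi$ a variable ranging over $W$) is called $\mathbf{M}$-mixed $(s;q)$-summable if there is a nonzero family $(\tau_j)_{j\in I}\in\ell_r(I)$ with $$\sup_{\psi\in W}\left[\sum_{j\in I}\left|\frac{\sigma_j}{\tau_j}\right|^s|\mathbf{M}(T,a_j,c_j,g_j,\psi)|^s\right]^{1/s}<\infty,$$ and one sets $$\mathfrak{m}^{\mathbf{M}}_{(s;q)}\left((\sigma_j,T,a_j,c_j,g_j,\psi)\right)_{j\in I}=\inf\left[\sum_{j\in I}|\tau_j|^r\right]^{1/r}\sup_{\psi\in W}\left[\sum_{j\in I}\left|\frac{\sigma_j}{\tau_j}\right|^s|\mathbf{M}(T,a_j,c_j,g_j,\psi)|^s\right]^{1/s},$$ the infimum being over all nonzero families $(\tau_j)_{j\in I}\in\ell_r(I)$. Convention: ''nonzero family'' means not identically zero, and if $\tau_j=0$ the $j$-th term (with $\sigma_j/\tau_j$) is read as $0$ when $\mathbf{M}(T,a_j,c_j,g_j,\psi)=0$ and as $+\infty$ otherwise. *)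

(* Defs.v *)
From HB Require Import structures.
From mathcomp Require Import all_boot all_order all_algebra.
From mathcomp Require Import all_classical all_reals all_analysis.

Set Implicit Arguments.
Unset Strict Implicit.
Unset Printing Implicit Defensive.

Import Order.TTheory GRing.Theory Num.Theory.
Import numFieldNormedType.Exports.

Local Open Scope classical_set_scope.
Local Open Scope ring_scope.

(* "Non-void set" is rendered by [pointedType] (resp. [ptopologicalType]): the
   chosen point carries no further information. *)

Notation borelType W := (g_sigma_algebraType (@open W)).

(* The exponent r with 1/r + 1/s = 1/q. *)
Definition mixing_exponent (R : realType) (s q : R) : R := (q^-1 - s^-1)^-1.

Lemma mixing_exponentE (R : realType) (s q : R) :
  (mixing_exponent s q)^-1 + s^-1 = q^-1.
Proof. by rewrite /mixing_exponent invrK subrK. Qed.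

Lemma mixing_exponent_gt0 (R : realType) (s q : R) :
  0 < q -> q < s -> 0 < mixing_exponent s q.
Proof.
move=> q0 qs; rewrite /mixing_exponent invr_gt0 subr_gt0 ltf_pV2 //.
by rewrite posrE (lt_trans q0 qs).
Qed.

(* |sigma / tau|^s |m|^s.  Since x / 0 = 0 in the library, the case tau = 0 has
   to be treated separately: the term is then 0 if m = 0 and +oo otherwise. *)
Definition mixed_term (R : realType) (s sigma tau m : R) : \bar R :=
  if tau != 0 then (`|sigma / tau| `^ s * `|m| `^ s)%:E
  else if m == 0 then 0%:E else +oo%E.

Definition ell_norm (R : realType) (I : choiceType) (r : R) (tau : I -> R) :
    \bar R :=
  ((\esum_(j in [set: I]) (`|tau j| `^ r)%:E) `^ r^-1)%E.

Definition nonzero_ell (R : realType) (I : choiceType) (r : R) :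
    set (I -> R) :=
  [set tau | (exists j, tau j != 0) /\
             (\esum_(j in [set: I]) (`|tau j| `^ r)%:E < +oo)%E].

Definition mixed_sup (R : realType) (A B C G W : Type) (H : set (A -> B))
    (M : H -> A -> C -> G -> W -> R) (s : R) (I : choiceType)
    (sigma : I -> R) (T : H) (a : I -> A) (c : I -> C) (g : I -> G)
    (tau : I -> R) : \bar R :=
  ereal_sup [set ((\esum_(j in [set: I])
      mixed_term s (sigma j) (tau j) (M T (a j) (c j) (g j) psi)) `^ s^-1)%E
    | psi in [set: W]].

Definition mixed_summable (R : realType) (A B C G W : Type)
    (H : set (A -> B)) (M : H -> A -> C -> G -> W -> R) (s q : R)
    (I : choiceType) (sigma : I -> R) (T : H)
    (a : I -> A) (c : I -> C) (g : I -> G) : Prop :=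
  exists2 tau : I -> R, nonzero_ell (mixing_exponent s q) tau &
    (mixed_sup M s sigma T a c g tau < +oo)%E.

Definition mixed_const (R : realType) (A B C G W : Type)
    (H : set (A -> B)) (M : H -> A -> C -> G -> W -> R) (s q : R)
    (I : choiceType) (sigma : I -> R) (T : H)
    (a : I -> A) (c : I -> C) (g : I -> G) : \bar R :=
  ereal_inf [set (ell_norm (mixing_exponent s q) tau *
                  mixed_sup M s sigma T a c g tau)%E
    | tau in nonzero_ell (mixing_exponent s q)].

Definition integral_norm (R : realType) (A B C G : Type) (W : ptopologicalType)
    (H : set (A -> B)) (M : H -> A -> C -> G -> W -> R) (s q : R)
    (I : choiceType) (sigma : I -> R) (T : H)
    (a : I -> A) (c : I -> C) (g : I -> G)
    (mu : probability (borelType W) R) : \bar R :=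
  ((\esum_(j in [set: I])
     ((`|sigma j| `^ q)%:E *
      (\int[mu]_psi (`|M T (a j) (c j) (g j) psi| `^ s)%:E) `^ (q / s)))
   `^ q^-1)%E.

(* Main.v *)
(* Put theta = q/s and phi_j = (|sigma_j| |M_j|)^s; the integral expression is
   then E(mu)^(1/q) with E(mu) = sum_j (int phi_j dmu)^theta, and a mixing family
   tau amounts to weights x_j >= 0, |tau_j|^r = x_j^theta, with
   sum_j x_j^theta <= A and sum_j x_j^(theta-1) phi_j <= B pointwise.  Hoelder's
   inequality gives E(mu) <= A^(1-theta) B^theta.  Conversely, finiteness of E
   forces a uniform bound S, since otherwise a countable mixture of measures of
   large energy would have infinite energy.  Weights with A = B = S exist by
   compactness: each of the two conditions, restricted to finitely many j, is
   closed in the product of the segments [0, S^(1/theta)], and for finitely many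
   points psi_k of W it is met by x_j = int phi_j dmu, where mu maximises
   (a regularisation of) E among the measures carried by the psi_k: the pointwise
   inequality is the first-order condition at the maximum.  Thus only discrete
   measures are used here, and no weak-star compactness. *)

Require Import Defs.
From HB Require Import structures.
From mathcomp Require Import all_boot all_order all_algebra.
From mathcomp Require Import all_classical all_reals all_analysis.
From mathcomp Require Import finmap ring lra measurable_realfun.

Set Implicit Arguments.
Unset Strict Implicit.
Unset Printing Implicit Defensive.

Import Order.TTheory GRing.Theory Num.Theory.
Import numFieldNormedType.Exports.

Local Open Scope classical_set_scope.
Local Open Scope ring_scope.

(** * Powers with exponent [theta] in (0, 1): concavity and Hoelder's inequality *)

Lemma powRV (R : realType) (x a : R) : 0 <= x -> x^-1 `^ a = (x `^ a)^-1.
Proof.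
by move=> x0; rewrite -powR_inv1// -powRrM mulN1r powRN.
Qed.

Section powR_facts.
Variables (R : realType) (theta : R).
Hypotheses (theta_gt0 : 0 < theta) (theta_lt1 : theta < 1).
Implicit Types a b x y d e : R.

(** Young's inequality for a^(1-theta) and b^theta, with conjugate exponents 1/(1-theta) and
    1/theta. *)
Lemma weighted_AMGM a b : 0 <= a -> 0 <= b ->
  a `^ (1 - theta) * b `^ theta <= (1 - theta) * a + theta * b.
Proof.
move=> a0 b0; have t0 : 0 < 1 - theta by rewrite subr_gt0.
have := @conjugate_powR R (a `^ (1 - theta)) (b `^ theta)
  (1 - theta)^-1 theta^-1 (powR_ge0 _ _) (powR_ge0 _ _).
rewrite !invr_gt0 !invrK subrK -!powRrM !divff ?gt_eqF// !powRr1//.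
by rewrite [a * _]mulrC [b * _]mulrC; apply.
Qed.

(** Concavity: the graph of t^theta lies below its tangent at y. This is the weighted AM-GM
    inequality for y and x, multiplied by y^(theta-1). *)
Lemma powR_tangent x y : 0 <= x -> 0 < y ->
  theta * (y `^ (theta - 1) * (y - x)) <= y `^ theta - x `^ theta.
Proof.
move=> x0 y0.
have := ler_wpM2l (powR_ge0 y (theta - 1)) (weighted_AMGM (ltW y0) x0).
have -> : y `^ (theta - 1) * (y `^ (1 - theta) * x `^ theta) = x `^ theta.
  rewrite mulrA -powRD; last by rewrite (gt_eqF y0) implybT.
  by rewrite addrA subrK subrr powRr0 mul1r.
have := mulr_powRB1 (ltW y0) theta_gt0.
nra.
Qed.

(** Weighted AM-GM is applied termwise to t_j / A and v_j / B, where A and B are the two total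
    sums. *)
Lemma hoelder_sum (K : Type) (J : seq K) (t v : K -> R) :
  (forall j, 0 <= t j) -> (forall j, 0 <= v j) ->
  \sum_(j <- J) t j `^ (1 - theta) * v j `^ theta <=
  (\sum_(j <- J) t j) `^ (1 - theta) * (\sum_(j <- J) v j) `^ theta.
Proof.
move=> t0 v0; set A := \sum_(j <- J) t j; set B := \sum_(j <- J) v j.
have t1 : 0 < 1 - theta by rewrite subr_gt0.
have A0 : 0 <= A by apply: sumr_ge0.
have B0 : 0 <= B by apply: sumr_ge0.
(* A vanishing sum cannot be normalised; all its terms, hence all the products, are then zero. *)
have zero (u : K -> R) : (forall j, 0 <= u j) -> \sum_(j <- J) u j = 0 ->
    forall (F : K -> R), (forall j, u j = 0 -> F j = 0) ->
    \sum_(j <- J) F j = 0.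
  move=> u0; elim: J {A B A0 B0} => [|j J IH]; first by move=> *; rewrite big_nil.
  rewrite big_cons => /eqP; rewrite paddr_eq0 ?sumr_ge0//.
  by move=> /andP[/eqP uj /eqP uJ] F FE; rewrite big_cons FE// add0r IH.
have [A_eq0|Aneq0] := eqVneq A 0.
  rewrite (zero t)// ?mulr_ge0 ?powR_ge0// => j ->.
  by rewrite powR0 ?mul0r// gt_eqF.
have [B_eq0|Bneq0] := eqVneq B 0.
  rewrite (zero v)// ?mulr_ge0 ?powR_ge0// => j ->.
  by rewrite powR0 ?mulr0// gt_eqF.
have Agt0 : 0 < A by rewrite lt_neqAle eq_sym Aneq0.
have Bgt0 : 0 < B by rewrite lt_neqAle eq_sym Bneq0.
rewrite -[leRHS]mulr1.
rewrite -ler_pdivrMl ?mulr_gt0 ?powR_gt0// mulr_sumr.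
apply: (@le_trans _ _
    (\sum_(j <- J) ((1 - theta) * (t j / A) + theta * (v j / B)))).
  apply: ler_sum => j _.
  apply: le_trans (weighted_AMGM _ _); rewrite ?divr_ge0//.
  by rewrite !powRM ?invr_ge0// !powRV// [leRHS]mulrACA -invfM mulrC.
by rewrite big_split/= -!mulr_sumr -!mulr_suml !divff// !mulr1 subrK lexx.
Qed.

Lemma powR_shift_le x d : 0 <= x -> 0 < d ->
  (x + d) `^ (theta - 1) * x <= x `^ theta.
Proof.
rewrite le_eqVlt => /predU1P[<- _|x0 d0]; first by rewrite mulr0 powR_ge0.
rewrite mulrC -(mulr_powRB1 (ltW x0) theta_gt0) ler_pM2l//.
have -> : theta - 1 = - (1 - theta) by rewrite opprB.
rewrite !powRN lef_pV2 ?posrE ?powR_gt0 ?addr_gt0//.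
by apply: ge0_ler_powR; rewrite ?nnegrE ?lerDl ?subr_ge0 ?addr_ge0// ltW.
Qed.

Lemma powR_shift_mono x d e : 0 <= x -> 0 < d -> d <= e ->
  (x + e) `^ (theta - 1) <= (x + d) `^ (theta - 1).
Proof.
move=> x0 d0 de; have -> : theta - 1 = - (1 - theta) by rewrite opprB.
have e0 := lt_le_trans d0 de.
rewrite !powRN lef_pV2 ?posrE ?powR_gt0 ?ltr_wpDl//.
by apply: ge0_ler_powR; rewrite ?nnegrE ?lerD2l ?subr_ge0 ?addr_ge0// ltW.
Qed.

End powR_facts.

(** * Limits of powers and sums; maximisation over a simplex *)

Lemma continuous_powRl (R : realType) (a x : R) : 0 < x ->
  {for x, continuous (fun y : R => y `^ a)}.
Proof.
move=> x0; apply: differentiable_continuous; apply/derivable1_diffP.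
by apply: derivable_powR; rewrite in_itv/= x0.
Qed.

Lemma cvg_powRl (R : realType) (T : Type) (F : set_system T) {FF : Filter F}
    (f : T -> R) (a x : R) :
  0 < x -> f @ F --> x -> (fun t => f t `^ a) @ F --> x `^ a.
Proof.
move=> x0 fx; apply: (cvg_comp f (fun y => y `^ a) fx).
exact: continuous_powRl.
Qed.

Lemma cvg_sum (R : realType) (T K : Type) (F : set_system T) {FF : Filter F}
    (J : seq K) (f : K -> T -> R) (l : K -> R) :
  (forall j, f j @ F --> l j) ->
  (fun t => \sum_(j <- J) f j t) @ F --> \sum_(j <- J) l j.
Proof.
move=> fl; apply: cvg_big => [|j _]; last exact: fl.
exact: add_continuous.
Qed.

Lemma simplex_compact (R : realType) n :
  compact [set l : 'rV[R]_n | (forall k, 0 <= l ord0 k) /\ \sum_k l ord0 k = 1].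
Proof.
have cc : compact [set l : 'rV[R]_n | forall k, l ord0 k \in `[0, 1]].
  by apply: (@rV_compact R n (fun=> `[0, 1]%classic)) => _; exact: segment_compact.
apply: (subclosed_compact _ cc); last first.
  move=> l [l0 l1] k /=; rewrite in_itv/= l0/= -l1 (bigD1 k)//= lerDl.
  by rewrite sumr_ge0.
have -> : [set l : 'rV[R]_n | (forall k, 0 <= l ord0 k) /\ \sum_k l ord0 k = 1] =
    \bigcap_k ((fun l : 'rV[R]_n => l ord0 k) @^-1` [set x | 0 <= x]) `&`
    (fun l : 'rV[R]_n => \sum_k l ord0 k) @^-1` [set 1].
  apply/seteqP; split => [l [l0 l1]|l [l0 l1]]; split => // k; last exact: l0.
  by move=> _; exact: l0.
apply: closedI.
  apply: closed_bigI => k _; apply: preimage_closed; last exact: closed_ge.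
  by move=> l _; exact: coord_continuous.
apply: preimage_closed; last exact: closed_eq.
by move=> l _; apply: (cvg_sum (F := nbhs l)) => k; exact: coord_continuous.
Qed.

(* First-order condition at a maximiser of sum_j (x_j(l) + d)^theta over the
   simplex, x_j(l) = sum_k l_k f_kj; the shift d keeps the function smooth. *)
Lemma simplex_stationary (R : realType) (theta d : R) (n : nat) (K : Type)
    (J : seq K) (f : 'I_n.+1 -> K -> R) :
  0 < theta -> theta < 1 -> 0 < d -> (forall k j, 0 <= f k j) ->
  exists l : 'I_n.+1 -> R, [/\ (forall k, 0 <= l k), \sum_k l k = 1 &
    forall i, \sum_(j <- J) (\sum_k l k * f k j + d) `^ (theta - 1) * f i j <=
              \sum_(j <- J) (\sum_k l k * f k j) `^ theta].
Proof.
move=> t0 t1 d0 f0.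
pose A := [set l : 'rV[R]_n.+1 |
  (forall k, 0 <= l ord0 k) /\ \sum_k l ord0 k = 1].
pose x j (l : 'rV[R]_n.+1) := \sum_k l ord0 k * f k j.
pose F l := \sum_(j <- J) (x j l + d) `^ theta.
have x0 j l : A l -> 0 <= x j l.
  by move=> [l0 _]; apply: sumr_ge0 => k _; rewrite mulr_ge0.
have cx j : continuous (x j).
  move=> l; apply: (cvg_sum (F := nbhs l)) => k; apply: cvgMl; exact: coord_continuous.
have cF : {within A, continuous F}.
  apply: continuous_in_subspaceT => l /set_mem Al.
  apply: (cvg_sum (F := nbhs l)) => j; apply: cvg_powRl; first by rewrite ltr_wpDl// x0.
  by apply: cvgD; [exact: cx|exact: cvg_cst].
have A0 : A !=set0.
  exists (\row_k (k == ord0)%:R); split; first by move=> k; rewrite mxE.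
  rewrite (bigD1 ord0)//= mxE eqxx big1 ?addr0// => k k0.
  by rewrite mxE (negbTE k0).
have [l /set_mem Al lmax] := EVT_max_rV A0 (@simplex_compact R n.+1) cF.
exists (fun k => l ord0 k); split; [exact: Al.1|exact: Al.2|move=> i].
(* With the right-hand side replaced by this smaller sum, the claim says that F has nonpositive
   derivative at l towards the vertex i. *)
apply: (@le_trans _ _ (\sum_(j <- J) (x j l + d) `^ (theta - 1) * x j l));
  last by apply: ler_sum => j _; apply: powR_shift_le => //; exact: x0.
rewrite -subr_le0 -sumrB.
under eq_bigr do rewrite -mulrBr.
(* [theta * u h] is the slope of F at parameter h on the segment from l to the vertex i. *)
pose u h := \sum_(j <- J) (x j l + d + h * (f i j - x j l)) `^ (theta - 1) *
  (f i j - x j l).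
have u0 : u h @[h --> 0^'+] -->
    \sum_(j <- J) (x j l + d) `^ (theta - 1) * (f i j - x j l).
  apply: cvg_sum => j; apply: cvgMl; apply: cvg_powRl.
    by rewrite ltr_wpDl// x0.
  rewrite -[X in _ --> X]addr0; apply: cvgD; first exact: cvg_cst.
  rewrite -[X in _ --> X](mul0r (f i j - x j l)); apply: cvgMl.
  exact: (cvg_at_right_filter (@cvg_id _ (nbhs 0))).
apply: (cvgr_to_le u0); near=> h.
have h0 : 0 < h by near: h; exact: nbhs_right_gt.
have h1 : h <= 1 by near: h; apply: nbhs_right_le.
pose l' := \row_k ((1 - h) * l ord0 k + h * (k == i)%:R).
have Al' : A l'.
  split=> [k|].
    by rewrite mxE addr_ge0 ?mulr_ge0 ?subr_ge0 ?(ltW h0) ?Al.1.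
  under eq_bigr do rewrite mxE.
  rewrite big_split/= -!mulr_sumr Al.2 (bigD1 i)//= eqxx big1 => [|k /negbTE ->//].
  by rewrite addr0 !mulr1 subrK.
have xl' j : x j l' = x j l + h * (f i j - x j l).
  rewrite /x; under eq_bigr do rewrite mxE mulrDl -!mulrA.
  rewrite big_split/= -!mulr_sumr -/(x j l) [X in _ + h * X](bigD1 i)//=.
  rewrite eqxx big1 => [|k /negbTE ->]; last by rewrite mul0r.
  by rewrite addr0 mul1r; ring.
rewrite -(pmulr_rle0 _ (mulr_gt0 t0 h0)).
apply: (@le_trans _ _ (F l' - F l)); last by rewrite subr_le0; exact/lmax/mem_set.
rewrite /u mulr_sumr -sumrB; apply: ler_sum => j _.
(* The tangent is taken at the moved point l', not at l: summed over j, this bounds F l' - F l below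
   by theta h u(h), so u(h) <= 0 without differentiating F. *)
have := powR_tangent t0 t1 (addr_ge0 (x0 j l Al) (ltW d0))
  (ltr_wpDl (x0 j l' Al') d0).
apply: le_trans; rewrite xl' le_eqVlt; apply/orP; left; apply/eqP.
rewrite [_ + _ + d]addrAC; set p := _ `^ _; ring.
Unshelve. all: by end_near.
Qed.

(** * Existence of dominating weights by compactness *)

Lemma ler_sum_fset (R : realType) (I : choiceType) (A B : {fset I}) (F : I -> R) :
  (A `<=` B)%fset -> (forall i, 0 <= F i) ->
  \sum_(i <- A) F i <= \sum_(i <- B) F i.
Proof.
move=> /fsubsetP AB F0; rewrite [leRHS](bigID (mem A))/=.
suff -> : \sum_(i <- B | i \in A) F i = \sum_(i <- A) F i.
  by rewrite lerDl sumr_ge0.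
rewrite -big_filter; apply: perm_big; apply: uniq_perm.
- by rewrite filter_uniq// fset_uniq.
- exact: fset_uniq.
- by move=> i; rewrite mem_filter; case: (boolP (i \in A)) => //= /AB ->.
Qed.

(* The constraints are closed conditions on points of a product of segments;
   finitely many of them are met by the stationary point of a simplex. *)
Lemma domination_regularized (R : realType) (I : choiceType) (W : pointedType)
    (theta S : R) (phi : I -> W -> R) :
  0 < theta -> theta < 1 -> 0 <= S -> (forall j psi, 0 <= phi j psi) ->
  (forall n (l : 'I_n.+1 -> R) (psi : 'I_n.+1 -> W) (J : {fset I}),
    (forall k, 0 <= l k) -> \sum_k l k = 1 ->
    \sum_(j <- J) (\sum_k l k * phi j (psi k)) `^ theta <= S) ->
  exists2 x : I -> R, (forall j, 0 <= x j) &
    forall (J : {fset I}) d, 0 < d ->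
      \sum_(j <- J) (x j + d) `^ (theta - 1) * x j <= S /\
      forall psi, \sum_(j <- J) (x j + d) `^ (theta - 1) * phi j psi <= S.
Proof.
move=> t0 t1 S0 phi0 phiS.
pose Y := prod_topology (fun _ : I => R).
pose X : ptopologicalType := HB.pack Y (Topological.on Y) (Pointed.on Y).
pose Box := [set x : X | forall j, `[0, S `^ theta^-1]%classic (x j)].
have cBox : compact Box.
  apply: (@tychonoff I (fun=> R) (fun=> `[0, S `^ theta^-1]%classic)) => _.
  exact: segment_compact.
pose idx := (W * {fset I} * R)%type.
pose D := [set e : idx | 0 < e.2].
(* The absolute value keeps the base at least d > 0, so [h] is continuous on the whole product and
   not only on [Box]. *)
pose h (c : I -> R -> R) (J : {fset I}) (d : R) (x : X) : R :=
  \sum_(j <- J) (`|x j| + d) `^ (theta - 1) * c j (x j).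
pose g (e : idx) := [set x : X | h (fun _ y => `|y|) e.1.2 e.2 x <= S] `&`
  [set x : X | h (fun j _ => phi j e.1.1) e.1.2 e.2 x <= S].
have hcont c J d : 0 < d -> (forall j, continuous (c j)) -> continuous (h c J d).
  move=> d0 cc x; apply: (cvg_sum (F := nbhs x)) => j.
  have xj : (fun y : X => y j) @ nbhs x --> x j 
    by exact: (@proj_continuous I (fun=> R) j x).
  apply: cvgM; last exact: (cvg_comp _ _ xj (cc j _)).
  apply: cvg_powRl; first by rewrite ltr_wpDl.
  by apply: cvgD; [exact: cvg_norm|exact: cvg_cst].
have hclosed c J d : 0 < d -> (forall j, continuous (c j)) ->
    closed [set x : X | h c J d x <= S].
  move=> d0 cc; apply: (@preimage_closed X R (h c J d) [set y | y <= S]).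
    by move=> x _; exact: hcont.
  exact: closed_le.
have fam : closed_fam_of Box D (fun e => Box `&` g e).
  exists g => // e e0; apply: closedI; apply: hclosed => // j y.
    exact: norm_continuous.
  exact: cvg_cst.
move: cBox; rewrite compact_In0 => /(_ idx D _ fam)[].
  move=> D' D'D.
  (* One finite set and one shift serve all constraints in [D']: enlarging the set and lowering the
     shift can only increase the sums. *)
  pose J := (\bigcup_(e <- D') e.1.2)%fset.
  pose d := \big[Num.min/1]_(e <- D') e.2.
  have d0 : 0 < d.
    rewrite /d big_seq; apply: (big_ind (fun y => 0 < y)).
    - by [].
    - by move=> a b a0 b0; rewrite lt_min a0.
    - by move=> e /D'D/set_mem.
  (* The extra [point] makes the list nonempty even when [D'] is empty. *)
  pose s := point :: [seq e.1.1 | e <- D'].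
  pose psi (k : 'I_(size [seq e.1.1 | e : idx <- D']).+1) : W := nth point s k.
  have [l [l0 l1 lS]] := simplex_stationary J t0 t1 d0
    (fun k j => phi0 j (psi k)).
  pose x j := if j \in J then \sum_k l k * phi j (psi k) else 0.
  have x0 j : 0 <= x j.
    by rewrite /x; case: ifP => // _; apply: sumr_ge0 => k _; rewrite mulr_ge0.
  have xJ : \sum_(j <- J) x j `^ theta <= S.
    apply: le_trans (phiS _ l psi J l0 l1); rewrite big_seq [leRHS]big_seq.
    by apply: ler_sum => j jJ; rewrite /x jJ.
  have xS j : x j `^ theta <= S.
    have [jJ|jJ] := boolP (j \in J); last first.
      by rewrite /x (negbTE jJ) powR0// gt_eqF.
    apply: le_trans xJ; rewrite (big_fsetD1 j)//= lerDl.
    by apply: sumr_ge0 => k _; exact: powR_ge0.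
  exists x => e /= eD'.
  have e0 : 0 < e.2 by have /D'D/set_mem := eD'.
  have de : d <= e.2 by apply: ge_bigmin_seq.
  have eJ : (e.1.2 `<=` J)%fset by apply: (@bigfcup_sup _ _ _ _ xpredT).
  have hle c : (forall j, 0 <= c j (x j)) -> h c e.1.2 e.2 x <=
      \sum_(j <- J) (x j + d) `^ (theta - 1) * c j (x j).
    move=> c0; apply: (@le_trans _ _
        (\sum_(j <- J) (x j + e.2) `^ (theta - 1) * c j (x j))).
      rewrite /h; under eq_bigr do rewrite ger0_norm//.
      by apply: ler_sum_fset => // j; rewrite mulr_ge0 ?powR_ge0.
    by apply: ler_sum => j _; rewrite ler_wpM2r// powR_shift_mono.
  split; last split => /=.
  - move=> j /=; rewrite in_itv/= x0/= -[leLHS]powRr1//.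
    rewrite -(divff (lt0r_neq0 t0)) powRrM ge0_ler_powR ?nnegrE ?powR_ge0//.
    by rewrite invr_ge0 ltW.
  - apply: le_trans (hle (fun _ y => `|y|) _) _; first by [].
    apply: le_trans xJ; apply: ler_sum => j _.
    by rewrite ger0_norm// powR_shift_le.
  - apply: le_trans (hle (fun j _ => phi j e.1.1) _) _; first by [].
    have es : e.1.1 \in s.
      by rewrite inE (map_f (fun e : idx => e.1.1) eD') orbT.
    have ks : (index e.1.1 s < (size [seq e.1.1 | e : idx <- D']).+1)%N.
      by rewrite -index_mem in es.
    have psik : psi (Ordinal ks) = e.1.1 by rewrite /psi nth_index.
    apply: le_trans (phiS _ l psi J l0 l1); apply: le_trans (lS (Ordinal ks)).
    rewrite big_seq [leRHS]big_seq.
    by apply: ler_sum => j jJ; rewrite /x jJ psik.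
move=> x xP.
have xB j : 0 <= x j.
  (* Any admissible index gives membership in [Box]. *)
  have [/(_ j)] := xP (point, fset0, 1) ltr01.
  by rewrite /= in_itv/= => /andP[].
exists x => // J d d0; split=> [|psi].
  have [_ [+ _]] := xP (point, J, d) d0; apply: le_trans.
  by rewrite le_eqVlt; apply/orP; left; apply/eqP; apply: eq_bigr => j _;
  rewrite ger0_norm.
have [_ [_ +]] := xP (psi, J, d) d0; apply: le_trans.
by rewrite le_eqVlt; apply/orP; left; apply/eqP; apply: eq_bigr => j _;
  rewrite ger0_norm.
Qed.

(** The shift d tends to 0 from the right. Where x_j = 0 the factor d^(theta-1) blows up, so the
    uniform bound forces c_j = 0; elsewhere the power is continuous. *)
Lemma regularization_limit (R : realType) (I : choiceType) (theta S : R)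
    (J : {fset I}) (x c : I -> R) :
  theta < 1 -> (forall j, 0 <= x j) -> (forall j, 0 <= c j) ->
  (forall d, 0 < d -> \sum_(j <- J) (x j + d) `^ (theta - 1) * c j <= S) ->
  (forall j, j \in J -> x j = 0 -> c j = 0) /\
  \sum_(j <- J) x j `^ (theta - 1) * c j <= S.
Proof.
move=> t1 x0 c0 cS.
have S0 : 0 <= S.
  apply: le_trans (cS 1 ltr01); apply: sumr_ge0 => j _.
  by rewrite mulr_ge0 ?powR_ge0.
have cz j : j \in J -> x j = 0 -> c j = 0.
  move=> jJ xj0; apply/eqP; rewrite eq_le c0 andbT leNgt; apply/negP => cj0.
  (* Chosen so that d^(theta-1) c_j = S + 1, which exceeds the bound. *)
  pose d := ((S + 1) / c j) `^ (theta - 1)^-1.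
  have p0 : 0 < (S + 1) / c j by rewrite divr_gt0// ltr_wpDl.
  have := cS d (powR_gt0 _ p0); rewrite (big_fsetD1 j)//= xj0 add0r.
  rewrite -powRrM mulVf ?subr_eq0 ?lt_eqF// powRr1 ?(ltW p0)//.
  rewrite divfK ?gt_eqF// leNgt => /negP; apply.
  apply: (@lt_le_trans _ _ (S + 1)); first by rewrite ltrDl.
  by rewrite lerDl sumr_ge0// => k _; rewrite mulr_ge0 ?powR_ge0.
split=> //.
(* Terms with x_j = 0 are left out, as the power is not continuous there: they are nonnegative
   before the limit and zero in the limiting sum. *)
have lim : (fun d => \sum_(j <- J)
      (if x j == 0 then 0 else (x j + d) `^ (theta - 1) * c j)) @ 0^'+ -->
    \sum_(j <- J) (if x j == 0 then 0 else x j `^ (theta - 1) * c j).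
  apply: cvg_sum => j; case: eqP => [_|/eqP xj]; first exact: cvg_cst.
  apply: cvgMl; apply: cvg_powRl; first by rewrite lt_neqAle eq_sym xj x0.
  rewrite -[X in _ --> X]addr0; apply: cvgD; first exact: cvg_cst.
  exact: (cvg_at_right_filter (@cvg_id _ (nbhs 0))).
have -> : \sum_(j <- J) x j `^ (theta - 1) * c j =
    \sum_(j <- J) (if x j == 0 then 0 else x j `^ (theta - 1) * c j).
  rewrite big_seq [RHS]big_seq; apply: eq_bigr => j jJ.
  by case: eqP => // xj; rewrite (cz j)// mulr0.
apply: (cvgr_to_le lim); near=> d.
apply: le_trans (cS d _); last by near: d; exact: nbhs_right_gt.
apply: ler_sum => j _; case: ifP => // _.
by rewrite mulr_ge0 ?powR_ge0.
Unshelve. all: by end_near.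
Qed.

(** * Countable mixtures of probabilities and unordered sums *)

Lemma probability_mixture d (T : measurableType d) (R : realType)
    (w : nat -> R) (mu : nat -> probability T R) :
  (forall n, 0 <= w n) -> (\sum_(n <oo) (w n)%:E = 1)%E ->
  exists P : probability T R, forall f : T -> \bar R,
    measurable_fun setT f -> (forall t, 0 <= f t)%E ->
    (\int[P]_t f t = \sum_(n <oo) (w n)%:E * \int[mu n]_t f t)%E.
Proof.
move=> w0 w1.
pose m n : {measure set T -> \bar R} := mscale (NngNum (w0 n)) (mu n).
pose s : {measure set T -> \bar R} := mseries m 0.
have s1 : s setT = 1%E.
  rewrite /s /= /mseries -w1; apply: eq_eseriesr => n _.
  by rewrite /m/= /mscale/= probability_setT mule1.
pose P : probability T R :=
  HB.pack (Measure.sort s) (Measure.class s) (Measure_isProbability.Build _ _ _ s s1).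
exists P => f mf f0.
have -> : (\int[P]_t f t = \int[s]_t f t)%E by [].
rewrite ge0_integral_measure_series//; apply: eq_eseriesr => n _.
by rewrite ge0_integral_mscale.
Qed.

Lemma esum_leP (R : realType) (I : choiceType) (a : I -> \bar R) (c : \bar R) :
  (\esum_(j in [set: I]) a j <= c)%E <->
  forall J : {fset I}, (\sum_(j <- J) a j <= c)%E.
Proof.
split=> [ac J|aJ].
  apply: le_trans ac; apply: esum_ge; exists [set` J]; first by split.
  by rewrite fsbig_finite//= set_fsetK.
by apply: ge_ereal_sup => _ [X [finX _] <-]; rewrite fsbig_finite.
Qed.

Lemma powR_neg_cancel (R : realType) (x a : R) : x != 0 ->
  x `^ a * x `^ (- a) = 1.
Proof. by move=> x0; rewrite -powRD ?subrr ?powRr0// x0 implybT. Qed.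

(** * The energy of a measure and its bounds *)

Definition energy d (T : measurableType d) (R : realType) (I : choiceType)
    (theta : R) (phi : I -> T -> R) (mu : probability T R) : \bar R :=
  (\esum_(j in [set: I]) (\int[mu]_t (phi j t)%:E) `^ theta)%E.

(* In terms of the mixing family, x_j = |tau_j|^(r / theta): the two sums are
   then those of |tau_j|^r and of |tau_j|^(-s) phi_j. *)
Definition dominates (R : realType) (I : choiceType) (W : Type)
    (theta : R) (phi : I -> W -> R) (x : I -> R) (A B : R) : Prop :=
  [/\ forall j, 0 <= x j,
      forall j psi, x j = 0 -> phi j psi = 0,
      forall J : {fset I}, \sum_(j <- J) x j `^ theta <= A &
      forall psi (J : {fset I}), \sum_(j <- J) x j `^ (theta - 1) * phi j psi <= B].

Section energy_facts.
Context d (T : measurableType d) (R : realType) (I : choiceType).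
Variables (theta : R) (phi : I -> T -> R).
Hypotheses (theta_gt0 : 0 < theta) (theta_lt1 : theta < 1).
Hypothesis phi_ge0 : forall j t, 0 <= phi j t.
Hypothesis mphi : forall j, measurable_fun setT (phi j).

Let mphiE j : measurable_fun setT (fun t => (phi j t)%:E).
Proof. exact/measurable_EFinP. Qed.

(** With e_j the integral of phi_j, e_j^theta = (x_j^theta)^(1-theta) (x_j^(theta-1) e_j)^theta.
    Hoelder's inequality separates the factors; the second sum is at most B by integrating the
    pointwise bound against a probability. *)
Lemma dominates_energy_le x A B (mu : probability T R) :
  dominates theta phi x A B ->
  (energy theta phi mu <= (A `^ (1 - theta) * B `^ theta)%:E)%E.
Proof.
move=> [x0 xphi xA xB]; apply/esum_leP => J.
have muT r : (\int[mu]_t r%:E = r%:E)%E.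
  by rewrite (integral_cst mu)// [X in (_ * X)%E](probability_setT mu) mule1.
(* A singleton J bounds each phi_j, so the integrals are finite; the empty J gives 0 <= B, needed
   when x_j = 0. *)
have phiB j t : phi j t <= x j `^ (1 - theta) * B.
  have [xj|xj] := eqVneq (x j) 0.
    by rewrite xphi// mulr_ge0 ?powR_ge0//; have := xB t fset0; rewrite big_nil.
  have := xB t [fset j]%fset; rewrite big_seq_fset1.
  move=> /(ler_wpM2l (powR_ge0 (x j) (1 - theta))); rewrite mulrA.
  by rewrite -[theta - 1]opprB powR_neg_cancel// mul1r.
have int_ge0 j : (0 <= \int[mu]_t (phi j t)%:E)%E.
  by apply: integral_ge0 => t _; rewrite lee_fin.
have int_fin j : (\int[mu]_t (phi j t)%:E)%E \is a fin_num.
  rewrite ge0_fin_numE//.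
  apply: (@le_lt_trans _ _ (\int[mu]_t (x j `^ (1 - theta) * B)%:E)%E).
    by apply: ge0_le_integral => // t _; rewrite lee_fin ?phiB.
  by rewrite muT ltry.
pose e j := fine (\int[mu]_t (phi j t)%:E)%E.
have e0 j : 0 <= e j by rewrite fine_ge0.
have -> : (\sum_(j <- J) (\int[mu]_t (phi j t)%:E) `^ theta)%E =
    (\sum_(j <- J) e j `^ theta)%:E.
  by rewrite -sumEFin; apply: eq_bigr => j _; rewrite -(fineK (int_fin j)).
rewrite lee_fin.
have eB : \sum_(j <- J) x j `^ (theta - 1) * e j <= B.
  rewrite -lee_fin -sumEFin.
  have -> : (\sum_(j <- J) (x j `^ (theta - 1) * e j)%:E =
      \sum_(j <- J) \int[mu]_t ((x j `^ (theta - 1))%:E * (phi j t)%:E))%E.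
    apply: eq_bigr => j _; rewrite EFinM fineK//.
    by rewrite ge0_integralZl_EFin ?powR_ge0// => t _; rewrite lee_fin.
  rewrite -ge0_integral_sum//; last 2 first.
  - by move=> j; apply: measurable_funeM.
  - by move=> j t _; rewrite mule_ge0 ?lee_fin ?powR_ge0.
  rewrite -[leRHS]muT; apply: ge0_le_integral => //.
  - by move=> t _; apply: sume_ge0 => j _; rewrite mule_ge0 ?lee_fin ?powR_ge0.
  - by apply: emeasurable_sum => j; apply: measurable_funeM.
  - by move=> t _; rewrite sumEFin lee_fin.
have xej j : e j `^ theta =
    (x j `^ theta) `^ (1 - theta) * (x j `^ (theta - 1) * e j) `^ theta.
  have [xj|xj] := eqVneq (x j) 0.
    have -> : e j = 0.
      rewrite /e integral0_eq// => t _.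
      by rewrite xphi.
    by rewrite mulr0 powR0 ?mulr0// gt_eqF.
  rewrite powRM ?powR_ge0// mulrA -!powRrM [theta * _]mulrC -[theta - 1]opprB.
  by rewrite mulNr powR_neg_cancel// mul1r.
under eq_bigr do rewrite xej.
apply: le_trans (hoelder_sum theta_gt0 theta_lt1 J _ _) _.
- by move=> j; exact: powR_ge0.
- by move=> j; rewrite mulr_ge0 ?powR_ge0.
have v0 : 0 <= \sum_(j <- J) x j `^ (theta - 1) * e j.
  by apply: sumr_ge0 => j _; rewrite mulr_ge0 ?powR_ge0.
have u0 : 0 <= \sum_(j <- J) x j `^ theta.
  by apply: sumr_ge0 => j _; rewrite powR_ge0.
apply: ler_pM; rewrite ?powR_ge0//; apply: ge0_ler_powR => //.
- by rewrite subr_ge0 ltW.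
- by rewrite nnegrE (le_trans u0).
- exact: ltW.
- by rewrite nnegrE (le_trans v0).
Qed.

End energy_facts.

Lemma nneseries_finite (R : realType) (N : nat) (a : nat -> \bar R) :
  (forall n, 0 <= a n)%E -> (forall n, (N <= n)%N -> a n = 0%E) ->
  (\sum_(n <oo) a n = \sum_(0 <= n < N) a n)%E.
Proof.
move=> a0 aN; rewrite (nneseries_split 0 N)// add0n.
by rewrite eseries0 ?adde0// => n Nn _; exact: aN.
Qed.

Lemma nneseries_half (R : realType) :
  (\sum_(n <oo) (1 / (2 ^ (n + 1))%:R : R)%:E = 1)%E.
Proof.
apply/cvg_lim => //.
by have := @cvg_geometric_eseries_half R 1 0; rewrite expr0 divr1.
Qed.

Section energy_bounds.
Context d (T : measurableType d) (R : realType) (I : choiceType).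
Variables (theta : R) (phi : I -> T -> R).
Hypotheses (theta_gt0 : 0 < theta).
Hypothesis phi_ge0 : forall j t, 0 <= phi j t.
Hypothesis mphi : forall j, measurable_fun setT (phi j).

Let mphiE j : measurable_fun setT (fun t => (phi j t)%:E).
Proof. exact/measurable_EFinP. Qed.

Let int_ge0 j (mu : probability T R) : (0 <= \int[mu]_t (phi j t)%:E)%E.
Proof. by apply: integral_ge0 => t _; rewrite lee_fin. Qed.

Let poweR_le (x y : \bar R) : (0 <= x -> x <= y -> x `^ theta <= y `^ theta)%E.
Proof.
move=> x0 xy; apply: gt0_ler_poweR => //; first exact: ltW.
- by rewrite in_itv/= leey x0.
- by rewrite in_itv/= leey (le_trans x0 xy).
Qed.

(** The bound is tested on the convex combination of Dirac measures at the points psi_k with weights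
    l_k. *)
Lemma energy_discrete_le (S : R) :
  (forall mu : probability T R, energy theta phi mu <= S%:E)%E ->
  forall n (l : 'I_n.+1 -> R) (psi : 'I_n.+1 -> T) (J : {fset I}),
    (forall k, 0 <= l k) -> \sum_k l k = 1 ->
    \sum_(j <- J) (\sum_k l k * phi j (psi k)) `^ theta <= S.
Proof.
move=> ES n l psi J l0 l1.
(* Mixtures are indexed by [nat], so l is extended by zero; the values of [inord] beyond n then
   carry no weight. *)
pose w k := if (k < n.+1)%N then l (inord k) else 0.
have w0 k : 0 <= w k by rewrite /w; case: ifP.
have wN k : (n.+1 <= k)%N -> w k = 0 by move=> nk; rewrite /w ltnNge nk.
have sumw (f : T -> R) : (forall t, 0 <= f t) ->
    (\sum_(k <oo) (w k)%:E * (f (psi (inord k)))%:E =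
     (\sum_k l k * f (psi k))%:E)%E.
  move=> f0; rewrite (@nneseries_finite R n.+1).
  - by rewrite big_mkord -sumEFin; apply: eq_bigr => k _;
      rewrite /w ltn_ord inord_val.
  - by move=> k; rewrite mule_ge0 ?lee_fin.
  - by move=> k /wN ->; rewrite mul0e.
have [|P PE] := @probability_mixture d T R w
    (fun k => dirac (psi (inord k)) : probability T R) w0.
  have := sumw (fun=> 1) (fun=> ler01).
  under eq_eseriesr do rewrite mule1.
  by under eq_bigr do rewrite mulr1; rewrite l1.
have /esum_leP/(_ J) := ES P.
have intP j : (\int[P]_t (phi j t)%:E = (\sum_k l k * phi j (psi k))%:E)%E.
  rewrite PE//; last by move=> t; rewrite lee_fin.
  rewrite -sumw//; apply: eq_eseriesr => k _.
  by rewrite integral_dirac// diracT mul1e.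
by under eq_bigr do rewrite intP poweR_EFin; rewrite sumEFin lee_fin.
Qed.

(** Otherwise choose mu_n of energy above n w_n^(-theta), with w_n = 2^(-n-1), and let P be the
    mixture of the mu_n with weights w_n. From w_n mu_n <= P the energy of mu_n is at most
    w_n^(-theta) times that of P, so P has energy above every n. *)
Lemma energy_bounded :
  (forall mu : probability T R, energy theta phi mu < +oo)%E ->
  exists2 S : R, 0 <= S &
    forall mu : probability T R, (energy theta phi mu <= S%:E)%E.
Proof.
move=> Efin; apply: contrapT => Eunb.
pose w n : R := 1 / (2 ^ (n + 1))%:R.
have w0 n : 0 < w n by rewrite divr_gt0// ltr0n expn_gt0.
have /choice[mu muE] : forall n, exists mu : probability T R,
    (energy theta phi mu > (n%:R * (w n)^-1 `^ theta)%:E)%E.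
  move=> n; apply: contrapT => h; apply: Eunb.
  exists (n%:R * (w n)^-1 `^ theta); first by rewrite mulr_ge0 ?powR_ge0.
  by move=> mu; rewrite leNgt; apply/negP => hmu; apply: h; exists mu.
have [P PE] := probability_mixture mu (fun n => ltW (w0 n)) (nneseries_half R).
have mu_le n j : (\int[mu n]_t (phi j t)%:E <=
    ((w n)^-1)%:E * \int[P]_t (phi j t)%:E)%E.
  rewrite lee_pdivlMl// PE//; last by move=> t; rewrite lee_fin.
  apply: le_trans (nneseries_lim_ge n.+1 _); last first.
    by move=> k _ _; rewrite mule_ge0// lee_fin ltW.
  rewrite big_nat_recr//= leeDr// sume_ge0// => k _.
  by rewrite mule_ge0// lee_fin ltW.
have mu_energy n : (energy theta phi (mu n) <=
    ((w n)^-1 `^ theta)%:E * energy theta phi P)%E.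
  apply/esum_leP => J.
  apply: (@le_trans _ _ (((w n)^-1 `^ theta)%:E *
      \sum_(j <- J) (\int[P]_t (phi j t)%:E) `^ theta))%E; last first.
    by rewrite lee_wpmul2l ?lee_fin ?powR_ge0//; move: J; exact/esum_leP.
  rewrite ge0_sume_distrr; last by move=> j _; exact: poweR_ge0.
  apply: lee_sum => j _; rewrite -poweR_EFin -poweRM ?int_ge0//.
    exact: poweR_le (int_ge0 _ _) (mu_le n j).
  by rewrite lee_fin invr_ge0 ltW.
have P0 : (0 <= energy theta phi P)%E by apply: esum_ge0 => j _; exact: poweR_ge0.
have Pfin : energy theta phi P \is a fin_num by rewrite ge0_fin_numE.
have := lt_le_trans (muE (Num.Def.archi_bound (fine (energy theta phi P)))) (mu_energy _).
rewrite -(fineK Pfin) -EFinM lte_fin mulrC ltr_pM2l ?powR_gt0 ?invr_gt0//.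
by rewrite ltNge => /negP; apply; apply/ltW/archi_boundP; rewrite fine_ge0.
Qed.

End energy_bounds.

Lemma continuous_borel_measurable (R : realType) (W : ptopologicalType)
    (f : W -> R) :
  continuous f -> measurable_fun [set: borelType W] (f : borelType W -> R).
Proof.
move=> /continuousP cf; apply: (measurability _ (RGenOpens.measurableE R)).
move=> _ [_ [a [b ->] <-]]; rewrite setTI; apply: sub_sigma_algebra.
exact/cf/interval_open.
Qed.

(** The regularisation is removed by two limits: c_j = phi_j(psi) gives the pointwise bound, and c_j
    = x_j gives the bound on the sum of x_j^theta. *)
Lemma exists_dominating (R : realType) (I : choiceType) (W : pointedType)
    (theta S : R) (phi : I -> W -> R) :
  0 < theta -> theta < 1 -> 0 <= S -> (forall j psi, 0 <= phi j psi) ->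
  (forall n (l : 'I_n.+1 -> R) (psi : 'I_n.+1 -> W) (J : {fset I}),
    (forall k, 0 <= l k) -> \sum_k l k = 1 ->
    \sum_(j <- J) (\sum_k l k * phi j (psi k)) `^ theta <= S) ->
  exists x, dominates theta phi x S S.
Proof.
move=> t0 t1 S0 phi0 /(domination_regularized t0 t1 S0 phi0)[x x0 xS].
have xphi psi (J : {fset I}) := regularization_limit t1 x0 (phi0^~ psi)
  (fun d d0 => (xS J d d0).2 psi).
exists x; split => // [j psi|J|psi J]; last exact: (xphi psi J).2.
  by apply: (xphi psi [fset j]%fset).1; rewrite inE.
have [_] := regularization_limit t1 x0 x0 (fun d d0 => (xS J d d0).1).
by under eq_bigr do rewrite mulrC mulr_powRB1//.
Qed.

(** * Translation between mixing families and dominating weights *)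

Section mixing.
Context (R : realType) (I : choiceType) (W : pointedType).
Variables (s q : R) (sigma : I -> R) (m : I -> W -> R).
Hypotheses (q_gt0 : 0 < q) (q_lt_s : q < s).
Hypothesis sigma_neq0 : forall j, sigma j != 0.

Let r := mixing_exponent s q.
Let theta := q / s.

Let s_gt0 : 0 < s. Proof. exact: lt_trans q_lt_s. Qed.
Let r_gt0 : 0 < r. Proof. exact: mixing_exponent_gt0. Qed.
Let theta_gt0 : 0 < theta. Proof. exact: divr_gt0. Qed.
Let theta_lt1 : theta < 1. Proof. by rewrite ltr_pdivrMr// mul1r. Qed.
Let onem_theta : 1 - theta = q / r.
Proof.
rewrite /r /mixing_exponent invrK mulrBr mulfV ?gt_eqF//.
Qed.

Definition mixing_weight j psi := `|sigma j| `^ s * `|m j psi| `^ s.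
Let phi := mixing_weight.

Lemma mixing_weight_ge0 j psi : 0 <= phi j psi.
Proof. by rewrite mulr_ge0 ?powR_ge0. Qed.

(** Since sigma_j is nonzero, the convention for tau_j = 0 can be read off the weight instead of
    m_j. *)
Lemma mixing_weight_eq0 j psi : (phi j psi == 0) = (m j psi == 0).
Proof.
rewrite mulf_eq0 !powR_eq0 !normr_eq0 (negbTE (sigma_neq0 j))/=.
by rewrite (gt_eqF s_gt0) andbT.
Qed.

(** The exponents match because 1 - theta = q/r = theta s / r, whence |tau|^(-s) = x^(theta-1). If x
    = 0, then tau = 0 and m vanishes, so the convention gives 0. *)
Lemma mixed_term_dominated (tau x : R) j psi : 0 <= x ->
  `|tau| = x `^ (theta / r) -> (x = 0 -> phi j psi = 0) ->
  mixed_term s (sigma j) tau (m j psi) = (x `^ (theta - 1) * phi j psi)%:E.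
Proof.
move=> x0 taux xphi; rewrite /mixed_term.
have tr0 : theta / r != 0 by rewrite gt_eqF// divr_gt0.
have -> : (tau != 0) = (x != 0).
  by rewrite -normr_eq0 taux powR_eq0 tr0 andbT.
have [xz|xn0] := eqVneq x 0.
  by rewrite -mixing_weight_eq0 -/(phi j psi) xphi// eqxx mulr0.
congr (_%:E); rewrite /phi /mixing_weight mulrA; congr (_ * _).
rewrite normf_div taux powRM ?invr_ge0 ?powR_ge0// mulrC; congr (_ * _).
rewrite powRV ?powR_ge0// -powRrM -powRN; congr (_ `^ _).
rewrite -[theta - 1]opprB onem_theta /theta; field.
by rewrite !gt_eqF.
Qed.

Lemma mixed_term_ge0 (sg tau y : R) : (0 <= mixed_term s sg tau y)%E.
Proof.
rewrite /mixed_term; case: ifP => _; first by rewrite lee_fin mulr_ge0 ?powR_ge0.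
by case: ifP.
Qed.

Let sup_norm (tau : I -> R) : \bar R :=
  ereal_sup [set ((\esum_(j in [set: I])
    mixed_term s (sigma j) (tau j) (m j psi)) `^ s^-1)%E | psi in [set: W]].

Let sup_norm_ge0 tau : (0 <= sup_norm tau)%E.
Proof.
apply: le_trans (ereal_sup_ubound _); last by exists point.
exact: poweR_ge0.
Qed.

(** A is the sum of |tau_j|^r, B the s-th power of the supremum, and x_j = |tau_j|^(r/theta). *)
Lemma mixing_dominates (tau : I -> R) :
  nonzero_ell r tau -> (sup_norm tau < +oo)%E ->
  exists A B x, [/\ dominates theta phi x A B,
    ell_norm r tau = (A `^ r^-1)%:E & sup_norm tau = (B `^ s^-1)%:E].
Proof.
move=> [_ tau_fin] sup_fin.
have tau_ge0 : (0 <= \esum_(j in [set: I]) (`|tau j| `^ r)%:E)%E.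
  by apply: esum_ge0 => j _; rewrite lee_fin powR_ge0.
have tauE : (\esum_(j in [set: I]) (`|tau j| `^ r)%:E)%E \is a fin_num.
  by rewrite ge0_fin_numE.
have sup_ge0 := sup_norm_ge0 tau.
have supE : sup_norm tau \is a fin_num by rewrite ge0_fin_numE.
pose A := fine (\esum_(j in [set: I]) (`|tau j| `^ r)%:E)%E.
pose B := fine (sup_norm tau) `^ s.
pose x j := `|tau j| `^ (r / theta).
have x0 j : 0 <= x j by exact: powR_ge0.
have taux j : `|tau j| = x j `^ (theta / r).
  by rewrite -powRrM mulrA divfK ?gt_eqF// mulfV ?gt_eqF// powRr1.
have mixB psi (J : {fset I}) :
    (\sum_(j <- J) mixed_term s (sigma j) (tau j) (m j psi) <= B%:E)%E.
  move: J; apply/esum_leP.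
  set e := esum _ _.
  have e0 : (0 <= e)%E by apply: esum_ge0 => j _; exact: mixed_term_ge0.
  rewrite -[e]poweRe1// -(mulVf (lt0r_neq0 s_gt0)) poweRrM -poweR_EFin fineK//.
  apply: gt0_ler_poweR; first exact: ltW.
  - by rewrite in_itv/= leey poweR_ge0.
  - by rewrite in_itv/= leey sup_ge0.
  - by apply: ereal_sup_ubound; exists psi.
(* A nonzero m_j where tau_j = 0 would contribute +oo, against the finite bound B. *)
have xphi j psi : x j = 0 -> phi j psi = 0.
  move=> xj; apply/eqP; rewrite mixing_weight_eq0; apply: contraT => mj.
  have tau0 : tau j = 0.
    by apply/eqP; rewrite -normr_eq0 taux xj powR0// gt_eqF// divr_gt0.
  have := mixB psi [fset j]%fset.
  by rewrite big_seq_fset1 /mixed_term tau0 eqxx/= (negbTE mj) leye_eq.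
exists A, B, x; split.
- split=> // [J|psi J].
    rewrite -lee_fin -sumEFin fineK//.
    have -> : (\sum_(j <- J) (x j `^ theta)%:E =
        \sum_(j <- J) (`|tau j| `^ r)%:E)%E.
      by apply: eq_bigr => j _; rewrite -powRrM divfK// gt_eqF.
    by move: J; apply/esum_leP.
  rewrite -lee_fin -sumEFin; apply: le_trans (mixB psi J).
  rewrite le_eqVlt; apply/orP; left; apply/eqP; apply: eq_bigr => j _.
  by rewrite (mixed_term_dominated (x0 j) (taux j))//; exact: xphi.
- by rewrite /ell_norm -(fineK tauE) poweR_EFin.
- by rewrite -powRrM mulfV ?gt_eqF// powRr1 ?fine_ge0// fineK.
Qed.

(** With tau_j = x_j^(theta/r) the two factors are at most S^(1/r) and S^(1/s), and 1/r + 1/s =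
    1/q. *)
Lemma dominates_mixing (S : R) (x : I -> R) (i0 : I) :
  0 <= S -> dominates theta phi x S S ->
  exists tau, [/\ nonzero_ell r tau, (sup_norm tau < +oo)%E &
    (ell_norm r tau * sup_norm tau <= (S `^ q^-1)%:E)%E].
Proof.
move=> S0 [x0 xphi xA xB].
have tr0 : 0 < theta / r by rewrite divr_gt0.
(* If x vanishes identically this tau would be zero, hence inadmissible; but then every m_j is zero,
   and the indicator of [i0] makes the product 0. *)
have [[j xj]|/forallNP x_eq0] := pselect (exists j, x j != 0); last first.
  have phi0 j psi : m j psi = 0.
    apply/eqP; rewrite -mixing_weight_eq0; apply/eqP/xphi/eqP.
    by apply/negPn/negP/x_eq0.
  have sup0 : sup_norm (fun j => (j == i0)%:R) = 0%E.
    apply/eqP; rewrite eq_le sup_norm_ge0 andbT.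
    apply: ge_ereal_sup => _ [psi _ <-].
    rewrite esum1 ?poweR0r ?invr_eq0 ?gt_eqF// => j _.
    rewrite /mixed_term phi0 eqxx normr0 (powR0 (lt0r_neq0 s_gt0)) mulr0.
    by case: ifP.
  exists (fun j => (j == i0)%:R); split; rewrite ?sup0 ?mule0 ?lee_fin ?powR_ge0//.
  split; first by exists i0; rewrite eqxx oner_neq0.
  have -> : (\esum_(j in [set: I]) (`|(j == i0)%:R : R| `^ r)%:E =
      \esum_(j in [set i0]) 1)%E.
    rewrite [RHS]esum_mkcond; apply: eq_esum => j _.
    case: ifPn => [/set_mem ->|/negP ji0]; first by rewrite eqxx normr1 powR1.
    have -> : (j == i0) = false by apply/eqP => jE; exact/ji0/mem_set.
    by rewrite normr0 powR0// gt_eqF.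
  by rewrite esum_set1 ?ltry.
pose tau j := x j `^ (theta / r).
have tauE j' : `|tau j'| = x j' `^ (theta / r) by rewrite ger0_norm ?powR_ge0.
have ellS : (\esum_(j in [set: I]) (`|tau j| `^ r)%:E <= S%:E)%E.
  apply/esum_leP => J; rewrite sumEFin lee_fin.
  under eq_bigr do rewrite tauE -powRrM divfK ?gt_eqF//.
  exact: xA.
have supS : (sup_norm tau <= (S `^ s^-1)%:E)%E.
  apply: ge_ereal_sup => _ [psi _ <-].
  rewrite -poweR_EFin; apply: gt0_ler_poweR; first by rewrite invr_ge0 ltW.
  - rewrite in_itv/= leey esum_ge0// => k _; exact: mixed_term_ge0.
  - by rewrite in_itv/= leey lee_fin S0.
  - apply/esum_leP => J.
    under eq_bigr => k _ do
      rewrite (mixed_term_dominated (x0 k) (tauE k) (xphi k psi)).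
    by rewrite sumEFin lee_fin.
exists tau; split.
- split; last exact: le_lt_trans ellS (ltry _).
  by exists j; rewrite powR_eq0 (negbTE xj).
- exact: le_lt_trans supS (ltry _).
have -> : S `^ q^-1 = S `^ r^-1 * S `^ s^-1.
  by rewrite -powRD mixing_exponentE// gt_eqF// invr_gt0.
rewrite EFinM; apply: lee_pmul => //; first exact: poweR_ge0.
rewrite -poweR_EFin; apply: gt0_ler_poweR => //; first by rewrite invr_ge0 ltW.
- by rewrite in_itv/= leey esum_ge0// => k _; rewrite lee_fin powR_ge0.
- by rewrite in_itv/= leey lee_fin S0.
Qed.

End mixing.

(** * Borel measurability of the weights and the final equivalence *)

Lemma normr_powR_measurable (R : realType) (W : ptopologicalType) (s : R)
    (f : W -> R) : continuous f ->
  measurable_fun [set: borelType W] (fun psi : borelType W => `|f psi| `^ s).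
Proof.
move=> cf.
apply: (measurableT_comp (f := fun x : R => `|x| `^ s) (g := f : borelType W -> R));
  last exact: continuous_borel_measurable.
by apply: (measurableT_comp (measurable_powR s)); exact: normr_measurable.
Qed.

Lemma mixing_weight_measurable (R : realType) (I : choiceType)
    (W : ptopologicalType) (s : R) (sigma : I -> R) (m : I -> W -> R) j :
  continuous (m j) ->
  measurable_fun [set: borelType W]
    (mixing_weight s sigma m j : borelType W -> R).
Proof.
move=> cm; apply: measurable_funM; first exact: measurable_cst.
exact: normr_powR_measurable.
Qed.

Lemma energy_mixing_weight (R : realType) (I : choiceType)
    (W : ptopologicalType) (s q : R) (sigma : I -> R) (m : I -> W -> R)
    (mu : probability (borelType W) R) :
  0 < s -> (forall j, continuous (m j)) ->
  energy (q / s) (mixing_weight s sigma m : I -> borelType W -> R) mu =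
  (\esum_(j in [set: I]) ((`|sigma j| `^ q)%:E *
    (\int[mu]_psi (`|m j psi| `^ s)%:E) `^ (q / s)))%E.
Proof.
move=> s0 cm; apply: eq_esum => j _.
rewrite /mixing_weight; under eq_integral do rewrite EFinM.
rewrite ge0_integralZl_EFin ?powR_ge0//; last first.
  by apply/measurable_EFinP; exact: normr_powR_measurable.
rewrite poweRM ?lee_fin ?powR_ge0 ?integral_ge0//.
by rewrite poweR_EFin -powRrM mulrC divfK ?gt_eqF.
Qed.

(** Excludes the product of 0 and +oo, which evaluates to 0, from the infimum in [mixed_const]. *)
Lemma ell_norm_gt0 (R : realType) (I : choiceType) (r : R) (tau : I -> R) :
  nonzero_ell r tau -> (0 < ell_norm r tau)%E.
Proof.
move=> [[j tau_j] _]; apply: poweR_gt0.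
apply: (@lt_le_trans _ _ (`|tau j| `^ r)%:E).
  by rewrite lte_fin powR_gt0// normr_gt0.
apply: esum_ge; exists [set j]; last by rewrite fsbig_set1.
by split => //; exact: finite_set1.
Qed.

Theorem proposition9 (R : realType) (A B C : pointedType)
    (H : set (A -> B)) (H_nonvoid : H !=set0)
    (G : completeNormedModType R)
    (W : ptopologicalType) (W_compact : compact [set: W])
    (W_hausdorff : hausdorff_space W)
    (I : pointedType)
    (M : H -> A -> C -> G -> W -> R)
    (s q : R) (q_gt0 : 0 < q) (q_lt_s : q < s)
    (M_continuous : forall (T : H) (a : A) (c : C) (g : G),
      continuous (fun psi : W => M T a c g psi))
    (T : H) (sigma : I -> R) (sigma_neq0 : forall j, sigma j != 0)
    (a : I -> A) (c : I -> C) (g : I -> G) :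
  (mixed_summable M s q sigma T a c g <->
    forall mu : probability (borelType W) R,
      (integral_norm M s q sigma T a c g mu < +oo)%E) /\
  (mixed_summable M s q sigma T a c g ->
    ereal_sup [set integral_norm M s q sigma T a c g mu
              | mu in [set: probability (borelType W) R]] =
    mixed_const M s q sigma T a c g).
Proof.
have s_gt0 : 0 < s := lt_trans q_gt0 q_lt_s.
have theta_gt0 : 0 < q / s by rewrite divr_gt0.
have theta_lt1 : q / s < 1 by rewrite ltr_pdivrMr// mul1r.
pose m j psi := M T (a j) (c j) (g j) psi.
pose phi : I -> borelType W -> R := mixing_weight s sigma m.
have cm j : continuous (m j) by exact: M_continuous.
have phi0 j psi : 0 <= phi j psi by exact: mixing_weight_ge0.
have mphi j : measurable_fun setT (phi j) by exact: mixing_weight_measurable.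
have normE mu : integral_norm M s q sigma T a c g mu =
    (energy (q / s) phi mu `^ q^-1)%E by rewrite energy_mixing_weight.
have energy_ge0 mu : (0 <= energy (q / s) phi mu)%E.
  by apply: esum_ge0 => j _; exact: poweR_ge0.
have supE tau : nonzero_ell (mixing_exponent s q) tau ->
    (mixed_sup M s sigma T a c g tau < +oo)%E -> exists A' B' x,
    [/\ dominates (q / s) phi x A' B',
      ell_norm (mixing_exponent s q) tau = (A' `^ (mixing_exponent s q)^-1)%:E &
      mixed_sup M s sigma T a c g tau = (B' `^ s^-1)%:E].
  exact: mixing_dominates.
have norm_le tau mu : nonzero_ell (mixing_exponent s q) tau ->
    (integral_norm M s q sigma T a c g mu <=
     ell_norm (mixing_exponent s q) tau * mixed_sup M s sigma T a c g tau)%E.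
  move=> tau_ell.
  have [|] := ltP (mixed_sup M s sigma T a c g tau) +oo%E; last first.
    by rewrite leye_eq => /eqP ->; rewrite gt0_muley ?leey ?ell_norm_gt0.
  move=> /(supE tau tau_ell)[A' [B' [x [dom -> ->]]]].
  rewrite normE -EFinM.
  (* The exponents agree since (1 - q/s)/q = 1/r and (q/s)/q = 1/s. *)
  have -> : A' `^ (mixing_exponent s q)^-1 * B' `^ s^-1 =
      (A' `^ (1 - q / s) * B' `^ (q / s)) `^ q^-1.
    rewrite powRM ?powR_ge0// -!powRrM; congr (_ `^ _ * _ `^ _).
      by rewrite /mixing_exponent invrK mulrBl mul1r mulrAC divff ?gt_eqF// mul1r.
    by rewrite mulrAC divff ?gt_eqF// mul1r.
  rewrite -poweR_EFin; apply: gt0_ler_poweR; first by rewrite invr_ge0 ltW.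
  - by rewrite in_itv/= leey energy_ge0.
  - by rewrite in_itv/= leey lee_fin mulr_ge0 ?powR_ge0.
  - exact: (dominates_energy_le theta_gt0 theta_lt1 phi0 mphi mu dom).
have tau_exists S : 0 <= S ->
    (forall mu, energy (q / s) phi mu <= S%:E)%E -> exists tau,
    [/\ nonzero_ell (mixing_exponent s q) tau,
        (mixed_sup M s sigma T a c g tau < +oo)%E &
        (ell_norm (mixing_exponent s q) tau * mixed_sup M s sigma T a c g tau
          <= (S `^ q^-1)%:E)%E].
  move=> S0 /(energy_discrete_le phi0 mphi).
  move=> /(exists_dominating theta_gt0 theta_lt1 S0 phi0)[x].
  exact: (dominates_mixing q_gt0 q_lt_s sigma_neq0 point S0).
have bound_lty tau : nonzero_ell (mixing_exponent s q) tau ->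
    (mixed_sup M s sigma T a c g tau < +oo)%E ->
    (ell_norm (mixing_exponent s q) tau * mixed_sup M s sigma T a c g tau < +oo)%E.
  by move=> ell /(supE tau ell)[A' [B' [x [_ -> ->]]]]; rewrite -EFinM ltry.
split; first split.
- move=> [tau tau_ell tau_sup] mu; apply: le_lt_trans (norm_le tau mu tau_ell) _.
  exact: bound_lty.
- move=> norm_fin; have [mu|S S0 ES] := energy_bounded theta_gt0 phi0 mphi.
    apply: (@lty_poweRy _ _ q^-1); first by rewrite invr_eq0 gt_eqF.
    by rewrite -normE.
  by have [tau [tau_ell tau_sup _]] := tau_exists S S0 ES; exists tau.
move=> [tau tau_ell tau_sup].
set K := ereal_sup _.
have K_le tau' : nonzero_ell (mixing_exponent s q) tau' ->
    (K <= ell_norm (mixing_exponent s q) tau' * mixed_sup M s sigma T a c g tau')%E.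
  by move=> ell'; apply: ge_ereal_sup => _ [mu _ <-]; exact: norm_le.
have norm_leK mu : (integral_norm M s q sigma T a c g mu <= K)%E.
  by apply: ereal_sup_ubound; exists mu.
have K0 : (0 <= K)%E.
  (* Here [point] is a probability measure, so K is a supremum over a nonempty set. *)
  by apply: le_trans (norm_leK point); rewrite normE poweR_ge0.
have Kfin : K \is a fin_num.
  by rewrite ge0_fin_numE// (le_lt_trans (K_le tau tau_ell))// bound_lty.
apply/eqP; rewrite eq_le; apply/andP; split.
  by apply: le_ereal_inf_tmp => _ [tau' ell' <-]; exact: K_le.
(* As K is finite, S = K^q bounds every energy, and S^(1/q) = K bounds the product for the resulting
   family. *)
have [mu|tau' [ell' _ le']] := tau_exists (fine K `^ q) (powR_ge0 _ _).
  rewrite -poweR_EFin fineK// -[leLHS]poweRe1// -(mulVf (lt0r_neq0 q_gt0)) poweRrM.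
  rewrite -normE; apply: gt0_ler_poweR; first exact: ltW.
  - by rewrite in_itv/= leey normE poweR_ge0.
  - by rewrite in_itv/= leey K0.
  - exact: norm_leK.
apply: (@le_trans _ _ (ell_norm (mixing_exponent s q) tau' *
    mixed_sup M s sigma T a c g tau')%E).
  by apply: ereal_inf_lbound; exists tau'.
move: le'; rewrite -powRrM mulfV ?gt_eqF// powRr1 ?fine_ge0//.
by rewrite fineK.
Qed.
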